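(* Let $a,b\in\mathbb{C}$ with $a\neq 0$. Then the $2$-valued dynamics on $\mathbb{C}$ given by $z\mapsto (a\sqrt z\pm b)^2$, i.e. $z\mapsto [(a\sqrt z+b)^2,(a\sqrt z-b)^2]$, is induced by a continuous action of the $2$-valued group $\mathcal{X}_{\mathbb{C}}$ on $\mathbb{C}$ with the element $([b],[a])\in\mathcal{X}_{\mathbb{C}}$.
   Context: Let $\iota$ denote the involution $f\mapsto -f$; $[a]$ with a single entry denotes the class $\{a,-a\}$, and $[x_1,\dots,x_k]$ with $k\geq 2$ denotes a multiset. $\operatorname{Sym}^m(S)$ is the set of $m$-element multisets of elements of $S$ (with the quotient topology from $S^m$ if $S$ is a topological space). An $m$-valued dynamics on $S$ is a map $T:S\to\operatorname{Sym}^m(S)$. The multiset $[(a\sqrt z+b)^2,(a\sqrt z-b)^2]$ does not depend on the choice of the square root of $z$. $\mathcal{X}_{\mathbb{C}}$ is the $2$-valued group $(\mathbb{C}/\iota)\times(\mathbb{C}^\times/\iota)$ (with the product of the quotient topologies) with the operation $$([a],[b])*([c],[d])=\bigl[([a+bc],[bd]),([a-bc],[bd])\bigr]$$ and unit $e=([0],[1])$. An action of an $m$-valued group $A$ with unit $e$ and multiplication $\mu$ on a set $S$ is a map $\nu:A\times S\to\operatorname{Sym}^m(S)$ such that (1) for all $a_1,a_2\in A$, $s\in S$ the $m^2$-element multisets $\nu(a_1,\nu(a_2,s))$ and $\nu(\mu(a_1,a_2),s)$ coincide (where $\nu$ applied to a multiset in one argument means the union with multiplicities of the values on its elements); (2)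 $\nu(e,s)=[s,\dots,s]$ for every $s\in S$. The action is continuous if $\nu$ is continuous. An $m$-valued dynamics $T$ on $S$ is induced by an action $\nu$ of $A$ on $S$ with an element $\alpha\in A$ if the multisets $T(s)$ and $\nu(\alpha,s)$ coincide for every $s\in S$. *)

(* Defs.v *)
From HB Require Import structures.
From mathcomp Require Import all_boot all_order all_algebra complex.
From mathcomp Require Import all_classical all_reals all_analysis.
From mathcomp Require Import ring.
Set Implicit Arguments.
Unset Strict Implicit.
Unset Printing Implicit Defensive.
Import Order.TTheory GRing.Theory Num.Theory.
Import numFieldNormedType.Exports.
Local Open Scope classical_set_scope.
Local Open Scope ring_scope.
Local Open Scope quotient_scope.

Section Multisets.
Context (m : nat) (S : choiceType).

(* Functions on ['I_m] under pointwise convergence are [S^m] with the product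
   topology. *)
Definition same_multiset : rel {ptws 'I_m -> S} :=
  fun f g => perm_eq (codom f) (codom g).

Lemma same_multiset_refl : reflexive same_multiset.
Proof. by move=> f; exact: perm_refl. Qed.

Lemma same_multiset_sym : symmetric same_multiset.
Proof. by move=> f g; exact: perm_sym. Qed.

Lemma same_multiset_trans : transitive same_multiset.
Proof. by move=> f g h; exact: perm_trans. Qed.

Canonical same_multiset_equiv := EquivRel same_multiset
  same_multiset_refl same_multiset_sym same_multiset_trans.

Definition Sym : Type := quotient_topology {eq_quot same_multiset}.

Definition msym (t : m.-tuple S) : Sym :=
  \pi_Sym (tnth t : {ptws 'I_m -> S}).

(* The elements in an unspecified order, so lists of values are to be compared
   up to [perm_eq]. *)
Definition values (x : Sym) : seq S := codom (repr x).

Lemma codom_tnth (t : m.-tuple S) : codom (tnth t) = t.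
Proof. by rewrite /codom /image_mem map_tnth_enum. Qed.

Lemma msym_eq (t u : m.-tuple S) : msym t = msym u <-> perm_eq t u.
Proof.
rewrite -(codom_tnth t) -(codom_tnth u); split=> [/eqquotP //|tu].
exact/eqquotP.
Qed.

Lemma values_msym (t : m.-tuple S) : perm_eq (values (msym t)) t.
Proof.
rewrite -[X in perm_eq _ X](codom_tnth t) /values.
have /eqquotP := reprK (msym t).
by [].
Qed.

End Multisets.

(* [spread f s] is the union with multiplicities of the multisets [f x] for
   [x] in [s]. *)
Definition spread (m : nat) (S S' : choiceType) (f : S -> Sym m S')
    (s : seq S) : seq S' :=
  flatten [seq values (f x) | x <- s].

Lemma spread_perm m (S S' : choiceType) (f : S -> Sym m S') (s t : seq S) :
  perm_eq s t -> perm_eq (spread f s) (spread f t).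
Proof. by move=> st; apply: perm_flatten; apply: perm_map. Qed.

Record mvgroup (m : nat) (A : choiceType) := MVGroup {
  mvmul : A -> A -> Sym m A;
  mvone : A;
  mvinv : A -> A;
  mvmulA : forall x y z,
    perm_eq (spread (mvmul x) (values (mvmul y z)))
            (spread (mvmul^~ z) (values (mvmul x y)));
  mvmul1 : forall x, mvmul mvone x = msym [tuple of nseq m x];
  mvmulr1 : forall x, mvmul x mvone = msym [tuple of nseq m x];
  mvmulV : forall x, mvone \in values (mvmul (mvinv x) x);
  mvmulrV : forall x, mvone \in values (mvmul x (mvinv x))
}.

Definition mvdynamics (m : nat) (S : choiceType) := S -> Sym m S.

Definition is_action (m : nat) (A S : choiceType) (G : mvgroup m A)
    (nu : A * S -> Sym m S) : Prop :=
  (forall (a1 a2 : A) (s : S),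
     perm_eq (spread (fun t => nu (a1, t)) (values (nu (a2, s))))
             (spread (fun c => nu (c, s)) (values (mvmul G a1 a2)))) /\
  (forall s : S, nu (mvone G, s) = msym [tuple of nseq m s]).

Definition induced_by (m : nat) (A S : choiceType) (T : mvdynamics m S)
    (nu : A * S -> Sym m S) (alpha : A) : Prop :=
  forall s : S, T s = nu (alpha, s).

Section Involution.
Context (T : topologicalType) (i : T -> T) (iK : involutive i).

Definition same_orbit : rel T := fun x y => (y == x) || (y == i x).

Lemma same_orbit_refl : reflexive same_orbit.
Proof. by move=> x; rewrite /same_orbit eqxx. Qed.

Lemma same_orbit_sym : symmetric same_orbit.
Proof.
by move=> x y; rewrite /same_orbit eq_sym [y == i x]eq_sym (inv_eq iK).
Qed.

Lemma same_orbit_trans : transitive same_orbit.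
Proof.
move=> y x z /orP[]/eqP-> /orP[]/eqP->;
  by rewrite /same_orbit ?iK eqxx ?orbT.
Qed.

Definition same_orbit_equiv := EquivRel same_orbit
  same_orbit_refl same_orbit_sym same_orbit_trans.

Definition modinv : Type := quotient_topology {eq_quot same_orbit_equiv}.

Lemma modinv_eq (x y : T) :
  \pi_modinv x = \pi_modinv y <-> y = x \/ y = i x.
Proof.
split=> [/eqquotP /orP[]/eqP|xy]; [by left|by right|].
by apply/eqquotP/orP; case: xy => ->; rewrite eqxx; [left|right].
Qed.

End Involution.

(* The library puts no topology on the bare type [R[i]]; through this
   packaging it gets the one defined by the modulus. *)
Definition Cplx (R : realType) : numClosedFieldType := R[i].

Section X_C.
Context (R : realType).
Notation C := (Cplx R).

(* [set_type] carries the subspace topology. *)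
Definition Cunits : topologicalType := set_type [set z : C | z != 0].

Definition mkunit (z : C) (z0 : z != 0) : Cunits := exist _ z (mem_set z0).

Lemma unit_neq0 (u : Cunits) : val u != 0.
Proof. by have := set_mem (valP u). Qed.

Definition oppu (u : Cunits) : Cunits :=
  mkunit (etrans (congr1 negb (oppr_eq0 (val u))) (unit_neq0 u)).
Definition mulu (u v : Cunits) : Cunits :=
  mkunit (mulf_neq0 (unit_neq0 u) (unit_neq0 v)).
Definition invu (u : Cunits) : Cunits :=
  mkunit (invr_neq0 (unit_neq0 u)).

Lemma oppuK : involutive oppu.
Proof. by move=> u; apply: val_inj; rewrite /= opprK. Qed.

Definition oppCK : involutive (-%R : C -> C) := @opprK C.

Definition Cmod : topologicalType := modinv oppCK.
Definition Cumod : topologicalType := modinv oppuK.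

Definition clsC (z : C) : Cmod := \pi_(modinv oppCK) z.
Definition clsCu (u : Cunits) : Cumod := \pi_(modinv oppuK) u.

Definition XC : topologicalType := (Cmod * Cumod)%type.

(* The pair of classes [([a],[b])]. *)
Definition XCmk (a : C) (b : Cunits) : XC := (clsC a, clsCu b).

Definition reprC (x : Cmod) : C := repr (x : modinv oppCK).
Definition reprCu (x : Cumod) : Cunits := repr (x : modinv oppuK).

Definition XCmul_repr (a : C) (b : Cunits) (c : C) (d : Cunits) : Sym 2 XC :=
  msym [tuple XCmk (a + val b * c) (mulu b d);
              XCmk (a - val b * c) (mulu b d)].

Definition XCmul (x y : XC) : Sym 2 XC :=
  XCmul_repr (reprC x.1) (reprCu x.2) (reprC y.1) (reprCu y.2).

Definition XCone : XC := XCmk 0 (mkunit (oner_neq0 C)).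

Definition XCinv (x : XC) : XC :=
  XCmk (reprC x.1 / val (reprCu x.2)) (invu (reprCu x.2)).

Lemma XCmk_opp1 a b : XCmk (- a) b = XCmk a b.
Proof.
by congr pair; apply/(modinv_eq oppCK); right; rewrite opprK.
Qed.

Lemma XCmk_opp2 a b : XCmk a (oppu b) = XCmk a b.
Proof. by congr pair; apply/(modinv_eq oppuK); right; rewrite oppuK. Qed.

Lemma XCmk_repr x : XCmk (reprC x.1) (reprCu x.2) = x.
Proof.
case: x => x y; rewrite /XCmk /clsC /clsCu /reprC /reprCu /=.
by rewrite !reprK.
Qed.

Lemma reprC_cls a : reprC (clsC a) = a \/ reprC (clsC a) = - a.
Proof.
apply/(modinv_eq oppCK).
by rewrite /reprC reprK.
Qed.

Lemma reprCu_cls b : reprCu (clsCu b) = b \/ reprCu (clsCu b) = oppu b.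
Proof. by apply/(modinv_eq oppuK); rewrite /reprCu reprK. Qed.

Lemma msym2C (S : choiceType) (x y : S) :
  msym [tuple x; y] = msym [tuple y; x].
Proof. by apply/msym_eq; rewrite /= (perm_catC [:: x] [:: y]). Qed.

Lemma XCmul_repr_opp a b c d :
  [/\ XCmul_repr (- a) b c d = XCmul_repr a b c d,
      XCmul_repr a (oppu b) c d = XCmul_repr a b c d,
      XCmul_repr a b (- c) d = XCmul_repr a b c d &
      XCmul_repr a b c (oppu d) = XCmul_repr a b c d].
Proof.
have uN (u v : Cunits) : mulu (oppu u) v = oppu (mulu u v).
  by apply: val_inj; rewrite /= mulNr.
have uNr (u v : Cunits) : mulu u (oppu v) = oppu (mulu u v).
  by apply: val_inj; rewrite /= mulrN.
rewrite /XCmul_repr uN uNr !XCmk_opp2 /= mulNr mulrN opprK; split=> //.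
- rewrite msym2C -opprD XCmk_opp1.
  by rewrite -[in XCmk (- a + _) _](XCmk_opp1 (- a + _)) opprD opprK.
- exact: msym2C.
- exact: msym2C.
Qed.

(* The product does not depend on the representatives. *)
Lemma XCmulE a b c d : XCmul (XCmk a b) (XCmk c d) = XCmul_repr a b c d.
Proof.
have N1 a' b' c' d' : XCmul_repr (- a') b' c' d' = XCmul_repr a' b' c' d'.
  by case: (XCmul_repr_opp a' b' c' d').
have N2 a' b' c' d' : XCmul_repr a' (oppu b') c' d' = XCmul_repr a' b' c' d'.
  by case: (XCmul_repr_opp a' b' c' d').
have N3 a' b' c' d' : XCmul_repr a' b' (- c') d' = XCmul_repr a' b' c' d'.
  by case: (XCmul_repr_opp a' b' c' d').
have N4 a' b' c' d' : XCmul_repr a' b' c' (oppu d') = XCmul_repr a' b' c' d'.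
  by case: (XCmul_repr_opp a' b' c' d').
rewrite /XCmul /=; have [->|->] := reprC_cls a; have [->|->] := reprCu_cls b;
have [->|->] := reprC_cls c; have [->|->] := reprCu_cls d;
by rewrite ?N1 ?N2 ?N3 ?N4.
Qed.

Lemma XC_ind (P : XC -> Prop) : (forall a b, P (XCmk a b)) -> forall x, P x.
Proof. by move=> PXC x; rewrite -(XCmk_repr x). Qed.

Lemma spread_XCmul_repr (f : XC -> Sym 2 XC) a b c d :
  perm_eq (spread f (values (XCmul_repr a b c d)))
    (values (f (XCmk (a + val b * c) (mulu b d))) ++
     values (f (XCmk (a - val b * c) (mulu b d)))).
Proof.
apply: (perm_trans (spread_perm f (values_msym _))).
by rewrite /spread /= cats0.
Qed.

Lemma XCmulA x y z :
  perm_eq (spread (XCmul x) (values (XCmul y z)))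
          (spread (XCmul^~ z) (values (XCmul x y))).
Proof.
elim/XC_ind: x => a b; elim/XC_ind: y => c d; elim/XC_ind: z => f g.
rewrite !XCmulE.
apply: (perm_trans (spread_XCmul_repr _ _ _ _ _)).
rewrite perm_sym; apply: (perm_trans (spread_XCmul_repr _ _ _ _ _)).
rewrite !XCmulE perm_sym.
apply: (perm_trans (perm_cat (values_msym _) (values_msym _))).
rewrite perm_sym.
apply: (perm_trans (perm_cat (values_msym _) (values_msym _))).
have -> : mulu (mulu b d) g = mulu b (mulu d g).
  by apply: val_inj; rewrite /= mulrA.
rewrite /=; set u := mulu b _.
have -> : a + val b * c + val b * val d * f = a + val b * (c + val d * f).
  by ring.
have -> : a + val b * c - val b * val d * f = a + val b * (c - val d * f).
  by ring.
have -> : a - val b * c + val b * val d * f = a - val b * (c - val d * f).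
  by ring.
have -> : a - val b * c - val b * val d * f = a - val b * (c + val d * f).
  by ring.
rewrite perm_cons.
by rewrite (perm_catC [:: _; _] [:: _]).
Qed.

Lemma XCmul1 x : XCmul XCone x = msym [tuple of nseq 2 x].
Proof.
elim/XC_ind: x => a b; rewrite XCmulE.
have u1 : mulu (mkunit (oner_neq0 C)) b = b.
  by apply: val_inj; rewrite /= mul1r.
by rewrite /XCmul_repr u1 /= mul1r add0r sub0r XCmk_opp1; apply/msym_eq.
Qed.

Lemma XCmulr1 x : XCmul x XCone = msym [tuple of nseq 2 x].
Proof.
elim/XC_ind: x => a b; rewrite XCmulE.
have u1 : mulu b (mkunit (oner_neq0 C)) = b.
  by apply: val_inj; rewrite /= mulr1.
by rewrite /XCmul_repr u1 mulr0 addr0 subr0; apply/msym_eq.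
Qed.

Lemma XCmulV x : XCone \in values (XCmul (XCinv x) x).
Proof.
rewrite -{2}(XCmk_repr x) /XCinv XCmulE (perm_mem (values_msym _)).
set a := reprC _; set b := reprCu _.
rewrite !inE; apply/orP; right; apply/eqP; congr XCmk.
  by rewrite /= mulrC subrr.
by apply: val_inj; rewrite /= mulVf // unit_neq0.
Qed.

Lemma XCmulrV x : XCone \in values (XCmul x (XCinv x)).
Proof.
rewrite -{1}(XCmk_repr x) /XCinv XCmulE (perm_mem (values_msym _)).
set a := reprC _; set b := reprCu _.
rewrite !inE; apply/orP; right; apply/eqP; congr XCmk.
  by rewrite mulrCA mulfV ?unit_neq0 // mulr1 subrr.
by apply: val_inj; rewrite /= mulfV // unit_neq0.
Qed.

Definition XCgroup : mvgroup 2 XC :=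
  MVGroup XCmulA XCmul1 XCmulr1 XCmulV XCmulrV.

End X_C.

(* Main.v *)
Require Import Defs.
From mathcomp Require Import all_boot all_order all_algebra.
From mathcomp Require Import all_classical all_reals all_analysis.
From mathcomp Require Import ring.
Import Order.TTheory GRing.Theory Num.Theory numFieldNormedType.Exports.
Local Open Scope classical_set_scope.
Local Open Scope ring_scope.

(** The dynamics is the case [x = b], [u = a] of the formula
    [(u * sqrt z + x)^2, (u * sqrt z - x)^2].  In the coordinate [w] with
    [z = w^2] this is the two-valued map [w |-> u * w +- x], read modulo sign.
    Composing [w |-> u2 * w +- x2] with [w |-> u1 * w +- x1] gives the four
    numbers [(u1 * u2) * w +- x1 +- u1 * x2], which is the law of X_C: the
    action axioms amount to comparing these four numbers
    ([affsq_is_action]).  Changing the sign of [x], [u] or [w] permutes the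
    numbers [u * w + x] and [u * w - x] up to sign, so the multiset of their
    squares depends only on [x] and [u] modulo sign and on [z] ([affsqE]).

    For continuity, the square root has no continuous branch, but none is
    needed.  The parameters [(x, u, w)] map onto the domain of the action by
    the two quotient maps and by squaring, and the composite of the action with
    that map is a pair of polynomials followed by the quotient map to
    multisets, hence continuous.  A function is continuous as soon as its
    composite with an open surjection is ([continuous_of_open_map]); the
    quotient by a continuous involution is open ([open_map_modinv]), products
    of open maps are open ([open_map_prod]), and squaring is open because the
    distances [d1] and [d2] from [w] to the two square roots of [z] satisfy
    [d1 * d2 = |w^2 - z|], so one of them is small when [z] is close to [w^2]
    ([open_map_sqr]). *)

(** * Open maps *)

(** The neighbourhood form of openness, which composes directly with the
    filter-based definition of continuity. *)
Definition open_map {X Y : topologicalType} (p : X -> Y) :=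
  forall x A, nbhs x A -> nbhs (p x) (p @` A).

Lemma continuous_of_open_map {X Y Z : topologicalType} {p : X -> Y}
    {g : Y -> Z} :
  open_map p -> (forall y, exists x, p x = y) -> continuous (g \o p) ->
  continuous g.
Proof.
move=> op sp cgp y U gyU; have [x pxy] := sp y; rewrite -pxy in gyU *.
by apply: filterS (op x _ (cgp x U gyU)) => _ [t Ut <-].
Qed.

Lemma open_map_prod {X Y X' Y' : topologicalType} {p : X -> Y}
    {q : X' -> Y'} :
  open_map p -> open_map q -> open_map (fun t => (p t.1, q t.2)).
Proof.
move=> op oq [x x'] A [[B B'] /= [xB x'B'] sBA].
exists (p @` B, q @` B') => /=; first by split; [exact: op|exact: oq].
move=> [_ _] /= [[t Bt <-] [t' Bt' <-]].
by exists (t, t') => //; exact: sBA.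
Qed.

(** The preimage of the image of an open set [U] is the union of [U] and its
    translate by the involution. *)
Lemma open_map_modinv {T : topologicalType} {i : T -> T} (iK : involutive i) :
  continuous i -> open_map (\pi_(modinv iK)%qT : T -> modinv iK).
Proof.
move=> ci x A; rewrite nbhsE => -[U [oU Ux] sUA].
have oV : open (\pi_(modinv iK)%qT @` U : set (modinv iK)).
  rewrite /open /= /quotient_open.
  rewrite [X in open X](_ : _ = U `|` i @^-1` U).
    by apply: openU => //; move/continuousP: ci; exact.
  rewrite eqEsubset; split=> [y [t Ut /modinv_eq[]->]|y [Uy|Uy]] /=.
  - by left.
  - by right; rewrite /= iK.
  - by exists y.
  - by exists (i y) => //; apply/modinv_eq; right; rewrite iK.
apply: filterS (image_subset _ sUA) _.
by apply: open_nbhs_nbhs; split=> //; exists x.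
Qed.

(** If both square roots of [z] were at distance at least [e] from [w], then
    [|w^2 - z| = |w - sqrt z| * |w + sqrt z|] would be at least [e^2].  Hence
    the image of the ball of radius [e] around [w] contains the ball of radius
    [e^2] around [w^2]. *)
Lemma open_map_sqr {K : numClosedFieldType} : open_map (fun w : K => w ^+ 2).
Proof.
move=> w A /nbhs_ballP[e /= e0 eA]; apply/nbhs_ballP.
exists (e ^+ 2); first by rewrite /= exprn_gt0.
move=> z; rewrite -ball_normE /= -{1}(sqrtCK z) subr_sqr normrM => wz.
have [we|we] := real_ltP (normr_real (w - sqrtC z)) (gtr0_real e0).
  exists (sqrtC z); last exact: sqrtCK.
  by apply: eA; rewrite -ball_normE.
exists (- sqrtC z); last by rewrite sqrrN sqrtCK.
apply: eA; rewrite -ball_normE /= opprK.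
rewrite real_ltNge ?normr_real ?gtr0_real //; apply/negP => we'.
have := ler_pM (ltW e0) (ltW e0) we we'.
by rewrite -expr2 => /(lt_le_trans wz); rewrite ltxx.
Qed.

(** * Continuity of families of multisets *)

Lemma continuous_ptws {I : Type} {X V : topologicalType}
    (F : X -> {ptws I -> V}) :
  (forall i, continuous (fun x => F x i)) -> continuous F.
Proof.
move=> cF x; apply/cvg_sup => i.
exact: (@continuous_comp_initial _ _ _ (fun f => f i) F (cF i) x).
Qed.

Lemma continuous_msym2 {X : topologicalType} {K : numClosedFieldType}
    (f g : X -> K) :
  continuous f -> continuous g ->
  continuous (fun x => msym [tuple f x; g x] : Sym 2 K).
Proof.
move=> cf cg.
pose F x : {ptws 'I_2 -> K} := tnth [tuple f x; g x].
have cF : continuous F.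
  by apply: continuous_ptws => -[[|[|//]] i2].
move=> x; apply: (@continuous_comp _ _ _ F _ x (cF x)).
exact: pi_continuous.
Qed.

(** * The action *)

Lemma spread_msym2 (S S' : choiceType) (f : S -> Sym 2 S') (y z : S) :
  perm_eq (spread f (values (msym [tuple y; z])))
    (values (f y) ++ values (f z)).
Proof.
apply: (perm_trans (spread_perm f (values_msym _))).
by rewrite /spread /= cats0.
Qed.

Section Action.
Context (R : realType).
Notation C := (Cplx R).

Definition affsq_repr (x : C) (u : Cunits R) (w : C) : Sym 2 C :=
  msym [tuple (val u * w + x) ^+ 2; (val u * w - x) ^+ 2].

(** Evaluated at arbitrary representatives of the two classes and at one of the
    square roots; [affsqE] shows that the choices do not matter. *)
Definition affsq (t : XC R * C) : Sym 2 C :=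
  affsq_repr (reprC t.1.1) (reprCu t.1.2) (sqrtC t.2).

Lemma affsq_reprNx x u w : affsq_repr (- x) u w = affsq_repr x u w.
Proof. by rewrite /affsq_repr opprK msym2C. Qed.

Lemma affsq_reprNw x u w : affsq_repr x u (- w) = affsq_repr x u w.
Proof.
rewrite /affsq_repr msym2C mulrN.
by congr (msym [tuple _; _]); ring.
Qed.

Lemma affsq_reprNu x u w : affsq_repr x (oppu u) w = affsq_repr x u w.
Proof. by rewrite -[RHS]affsq_reprNw /affsq_repr /= mulNr mulrN. Qed.

Lemma affsqE x u w : affsq (XCmk x u, w ^+ 2) = affsq_repr x u w.
Proof.
rewrite /affsq /=.
have /eqP : sqrtC (w ^+ 2) ^+ 2 = w ^+ 2 by exact: sqrtCK.
rewrite eqf_sqr => /orP[]/eqP->; have [->|->] := reprC_cls x;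
  have [->|->] := reprCu_cls u;
  by rewrite ?affsq_reprNw ?affsq_reprNx ?affsq_reprNu.
Qed.

Lemma affsq_is_action : is_action (XCgroup R) affsq.
Proof.
split=> [s t z|z]; last first.
  rewrite -(sqrtCK z) affsqE /affsq_repr /= mul1r addr0 subr0.
  exact/msym_eq.
elim/XC_ind: s => x u; elim/XC_ind: t => y v; rewrite -(sqrtCK z).
set w := sqrtC z; rewrite /= XCmulE affsqE.
apply: (perm_trans (spread_msym2 _ _ _ _ _)); rewrite perm_sym.
apply: (perm_trans (spread_msym2 _ _ _ _ _)); rewrite !affsqE perm_sym.
apply: (perm_trans (perm_cat (values_msym _) (values_msym _))).
rewrite perm_sym.
apply: (perm_trans (perm_cat (values_msym _) (values_msym _))).
rewrite /=; set a := val u; set b := val v.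
(* The four squares of the product side are those of the composition side,
   listed with the last three in reverse order. *)
have -> : (a * b * w + (x + a * y)) ^+ 2 = (a * (b * w + y) + x) ^+ 2 by ring.
have -> : (a * b * w - (x + a * y)) ^+ 2 = (a * (b * w - y) - x) ^+ 2 by ring.
have -> : (a * b * w + (x - a * y)) ^+ 2 = (a * (b * w - y) + x) ^+ 2 by ring.
have -> : (a * b * w - (x - a * y)) ^+ 2 = (a * (b * w + y) - x) ^+ 2 by ring.
by rewrite perm_cons -(perm_rev [:: _; _; _]).
Qed.

Lemma oppu_continuous : continuous (@oppu R).
Proof.
apply: (@continuous_comp_initial _ _ _ val) => u.
apply: (@continuous_comp _ _ _ (val : Cunits R -> C) -%R).
  exact: initial_continuous.
exact: opp_continuous.
Qed.

(** The square root is avoided by parametrizing [z] as [w^2]: along the open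
    surjection [p] below, the action becomes a pair of polynomials. *)
Lemma affsq_continuous : continuous affsq.
Proof.
pose p (t : C * Cunits R * C) : XC R * C := (XCmk t.1.1 t.1.2, t.2 ^+ 2).
have op : open_map p.
  have cN : continuous (-%R : C -> C) by exact: opp_continuous.
  exact: (open_map_prod (open_map_prod (open_map_modinv (@oppCK R) cN)
    (open_map_modinv (@oppuK R) oppu_continuous)) open_map_sqr).
apply: (continuous_of_open_map op) => [[s z]|].
  exists (reprC s.1, reprCu s.2, sqrtC z).
  by rewrite /p /= XCmk_repr sqrtCK.
rewrite [X in continuous X](_ : _ = fun t => affsq_repr t.1.1 t.1.2 t.2);
  last by apply/funext => t; exact: affsqE.
have cx : continuous (fun t : C * Cunits R * C => t.1.1).
  move=> t; apply: (@continuous_comp _ _ _ fst fst); exact: cvg_fst.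
have cuw : continuous (fun t : C * Cunits R * C => val t.1.2 * t.2).
  move=> t; apply: cvgM; last exact: cvg_snd.
  apply: (@continuous_comp _ _ _ (fun t => t.1.2) (val : Cunits R -> C)).
    by apply: (@continuous_comp _ _ _ fst snd); [exact: cvg_fst|exact: cvg_snd].
  exact: initial_continuous.
have csqr (h : C * Cunits R * C -> C) :
    continuous h -> continuous (fun t => h t ^+ 2).
  by move=> ch t; exact: (cvgM (ch t) (ch t)).
apply: continuous_msym2; apply: csqr => t.
  by apply: cvgD; [exact: cuw|exact: cx].
by apply: cvgB; [exact: cuw|exact: cx].
Qed.

End Action.

Theorem theorem1p3 (R : realType) (a b : Cplx R) (a0 : a != 0) :
  exists nu : XC R * Cplx R -> Sym 2 (Cplx R),
    [/\ is_action (XCgroup R) nu,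
        continuous nu &
        induced_by
          (fun z : Cplx R => msym [tuple (a * sqrtC z + b) ^+ 2;
                                         (a * sqrtC z - b) ^+ 2])
          nu (XCmk b (mkunit a0))].
Proof.
exists (@affsq R); split; [exact: affsq_is_action|exact: affsq_continuous|].
by move=> z; rewrite -[in RHS](sqrtCK z) affsqE.
Qed.
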